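(* The notion of verifiability depends only on the graph topology, the support of the outliers, and the sign of the outliers. Precisely: let $G=(V,E)$ be a connected oriented graph with $V=\{1,\dots,N\}$, let $x^{*}_V,\ y^{*}_V\in\mathbb{R}^V$ be two ground truth embeddings with $x^*_1=y^*_1=0$, and let $\epsilon_E=(\epsilon_{ij})_{(i,j)\in E}\in\mathbb{R}^E$ and $\eta_E=(\eta_{ij})_{(i,j)\in E}\in\mathbb{R}^E$ be two outlier realizations with the same signed support, i.e. $\operatorname{sign}(\epsilon_{ij})=\operatorname{sign}(\eta_{ij})\in\{-1,0,1\}$ for every $(i,j)\in E$. Then the localization problem on $G$ with ground truth $x^*_V$ and outliers $\epsilon_E$ is verifiable if and only if the localization problem on $G$ with ground truth $y^*_V$ and outliers $\eta_E$ is verifiable.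
   Context: An oriented graph $G=(V,E)$ has vertex set $V=\{1,\dots,N\}$ and edge set $E\subset V\times V$; connectedness refers to the underlying undirected graph. The setting is one-dimensional: an embedding is a vector in $\mathbb{R}^V$, and ground truth embeddings are normalized so that node $1$ is at $0$. Given a ground truth embedding $z^*_V\in\mathbb{R}^V$ and an outlier realization $\zeta_E=(\zeta_{ij})_{(i,j)\in E}\in\mathbb{R}^E$, the measurements are $t_{ij}=z^*_j-z^*_i+\zeta_{ij}$ for $(i,j)\in E$. The outlier support is $\{(i,j)\in E:\zeta_{ij}\neq 0\}$, and the signed outlier support is the outlier support with each of its edges paired with the sign of $\zeta_{ij}$. The localization optimization problem is $$\min_{x_V\in\mathbb{R}^V,\ x_1=0}\ \sum_{(i,j)\in E}|x_j-x_i-t_{ij}| ,$$ and $\mathcal{X}^{\mathrm{opt}}$ denotes its set of global minimizers. The localization problem is called verifiable if $z^*_V\in\mathcal{X}^{\mathrm{opt}}$ (there may be other minimizers). *)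

(* Defs.v *)
From mathcomp Require Import all_boot all_order all_algebra.
From mathcomp Require Import classical_sets reals.

Set Implicit Arguments.
Unset Strict Implicit.
Unset Printing Implicit Defensive.

Import Order.TTheory GRing.Theory Num.Theory.
Local Open Scope ring_scope.

(* The N >= 1 vertices 1, ..., N are the elements of ['I_n.+1] with N = n.+1;
   node 1 is [ord0].  The edge set is any E : {set 'I_n.+1 * 'I_n.+1}, and
   (i, j) \in E is oriented from i to j. *)

(* R^V *)
Notation node_vec R n := {ffun 'I_n.+1 -> R}.

(* R^E : one coordinate per edge, and none for the pairs outside E. *)
Notation edge_vec R E := {ffun {e | e \in E} -> R}.

Definition underlying_rel n (E : {set 'I_n.+1 * 'I_n.+1}) : rel 'I_n.+1 :=
  [rel i j | ((i, j) \in E) || ((j, i) \in E)].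

Definition connected_graph n (E : {set 'I_n.+1 * 'I_n.+1}) : Prop :=
  forall i j : 'I_n.+1, connect (underlying_rel E) i j.

Section Localization.
Variables (R : realType) (n : nat) (E : {set 'I_n.+1 * 'I_n.+1}).

Definition edge_src (e : {e | e \in E}) : 'I_n.+1 := (val e).1.
Definition edge_dst (e : {e | e \in E}) : 'I_n.+1 := (val e).2.

Definition measurement (z : node_vec R n) (zeta : edge_vec R E) :
    edge_vec R E :=
  [ffun e => z (edge_dst e) - z (edge_src e) + zeta e].

Definition loc_cost (t : edge_vec R E) (x : node_vec R n) : R :=
  \sum_(e : {e | e \in E}) `|x (edge_dst e) - x (edge_src e) - t e|.

Definition Xopt (t : edge_vec R E) : set (node_vec R n) :=
  [set x : node_vec R n | x ord0 = 0 /\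
     forall y : node_vec R n, y ord0 = 0 -> loc_cost t x <= loc_cost t y]%classic.

Definition verifiable (z : node_vec R n) (zeta : edge_vec R E) : Prop :=
  Xopt (measurement z zeta) z.

Definition same_signed_support (eps eta : edge_vec R E) : Prop :=
  forall e : {e | e \in E}, Num.sg (eps e) = Num.sg (eta e).

End Localization.

(* Main.v *)
Require Import Defs.
From mathcomp Require Import all_boot all_order all_algebra.
From mathcomp Require Import classical_sets reals.
From mathcomp Require Import ring lra.

Import Order.TTheory GRing.Theory Num.Theory.
Local Open Scope ring_scope.

(** Moving the embedding from the ground truth z to z + h changes each residual
    from -zeta_e to (dh)_e - zeta_e, so z itself drops out.  By convexity, z is
    optimal iff every one-sided directional derivative of the cost at z,
    [\sum_(e | zeta_e = 0) |(dh)_e| - \sum_e sg(zeta_e) (dh)_e], is nonnegative,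
    and this depends on zeta only through its signs. *)

(* The derivative at 0+ of [r |-> `|r * d - a|] when [s = Num.sg a]. *)
Definition abs_slope {R : realDomainType} (s d : R) : R :=
  (s == 0)%:R * `|d| - s * d.

Lemma abs_slopeM {R : realDomainType} (s r d : R) :
  0 <= r -> abs_slope s (r * d) = r * abs_slope s d.
Proof. by move=> r_ge0; rewrite /abs_slope normrM ger0_norm //; ring. Qed.

(** Convexity: the graph of [|d - a|] as a function of [d] lies above its one-sided tangents at
    [0]. *)
Lemma abs_slope_le {R : realDomainType} (a d : R) :
  `|a| + abs_slope (Num.sg a) d <= `|d - a|.
Proof.
rewrite /abs_slope; have [->|a_gt0|a_lt0] := sgrP a.
- by rewrite eqxx subr0 /=; lra.
- by rewrite oner_eq0 distrC /=; have := ler_norm (a - d); lra.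
- by rewrite oppr_eq0 oner_eq0 /=; have := ler_norm (d - a); lra.
Qed.

(** While [|d| <= |a|], [d - a] does not cross zero, so the absolute value stays on one linear
    piece. For [a = 0] the kink sits at the base point and no bound is required. *)
Lemma abs_slope_eq {R : realDomainType} (a d : R) :
  (a != 0 -> `|d| <= `|a|) -> `|d - a| = `|a| + abs_slope (Num.sg a) d.
Proof.
rewrite /abs_slope; have [->|a_gt0|a_lt0] := sgrP a => h.
- by rewrite eqxx subr0 /=; lra.
- have := h isT; rewrite ler_norml => /andP[_ da].
  by rewrite oner_eq0 ler0_norm /=; lra.
- have := h isT; rewrite ler_norml => /andP[da _].
  by rewrite oppr_eq0 oner_eq0 ger0_norm /=; lra.
Qed.

Lemma small_scaling {R : realFieldType} {I : finType} (d a : I -> R) :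
  exists2 r : R, 0 < r & forall i, a i != 0 -> `|r * d i| <= `|a i|.
Proof.
(* [c] dominates every ratio at once, and the [1] keeps it positive; indices with [a i = 0] add [0],
   since division by zero gives [0]. *)
pose c := 1 + \sum_i `|d i| / `|a i|.
have q_ge0 i : 0 <= `|d i| / `|a i| by rewrite divr_ge0.
have c_gt0 : 0 < c by rewrite ltr_pwDl // sumr_ge0.
exists c^-1 => [|i ai0]; first by rewrite invr_gt0.
rewrite normrM gtr0_norm ?invr_gt0 // ler_pdivrMl // -ler_pdivrMr ?normr_gt0 //.
rewrite /c (bigD1 i) //= addrCA lerDl addr_ge0 //.
by rewrite sumr_ge0.
Qed.

Section Verifiability.
Context {R : realType} {n : nat} {E : {set 'I_n.+1 * 'I_n.+1}}.
Implicit Types (h z : node_vec R n) (zeta : edge_vec R E).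

Definition edge_diff h (e : {e | e \in E}) : R :=
  h (edge_dst e) - h (edge_src e).

Definition cost_slope zeta h : R :=
  \sum_(e : {e | e \in E}) abs_slope (Num.sg (zeta e)) (edge_diff h e).

Lemma loc_cost_shift z zeta h :
  loc_cost (measurement z zeta) [ffun i => z i + h i] =
  \sum_(e : {e | e \in E}) `|edge_diff h e - zeta e|.
Proof.
apply: eq_bigr => e _; rewrite /edge_diff !ffunE; congr `|_|; ring.
Qed.

Lemma loc_cost_truth z zeta :
  loc_cost (measurement z zeta) z = \sum_(e : {e | e \in E}) `|zeta e|.
Proof.
by apply: eq_bigr => e _; rewrite ffunE -normrN; congr `|_|; ring.
Qed.

Lemma verifiable_slopeP z zeta : z ord0 = 0 ->
  verifiable z zeta <-> (forall h, h ord0 = 0 -> 0 <= cost_slope zeta h).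
Proof.
move=> z1; split=> [[_ z_min] h h1|slope_ge0].
  (* Shrinking [h] by [r] makes the first-order expansion exact on every edge, so the cost changes
     by exactly [r * cost_slope zeta h]. *)
  have [r r_gt0 small] := small_scaling (edge_diff h) zeta.
  pose rh : node_vec R n := [ffun i => r * h i].
  have d_rh e : edge_diff rh e = r * edge_diff h e.
    by rewrite /edge_diff !ffunE mulrBr.
  have := z_min [ffun i => z i + rh i].
  rewrite loc_cost_shift loc_cost_truth !ffunE z1 h1 mulr0 addr0 => /(_ erefl).
  under [leRHS]eq_bigr => e _.
    rewrite d_rh abs_slope_eq; last exact: small.
    rewrite abs_slopeM ?ltW //; over.
  by rewrite big_split /= -mulr_sumr lerDl pmulr_rge0.
split=> // y y1; pose h : node_vec R n := [ffun i => y i - z i].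
have -> : y = [ffun i => z i + h i] by apply/ffunP => i; rewrite !ffunE addrC subrK.
rewrite loc_cost_shift loc_cost_truth.
(* The tangent bound is global, so a competitor [y] arbitrarily far from [z] is handled without
   scaling. *)
apply: (@le_trans _ _ (\sum_e `|zeta e| + cost_slope zeta h)).
  by rewrite lerDl slope_ge0 // ffunE y1 z1 subr0.
by rewrite -big_split ler_sum //= => e _; apply: abs_slope_le.
Qed.

Lemma cost_slope_sg {eps eta : edge_vec R E} h :
  same_signed_support eps eta -> cost_slope eps h = cost_slope eta h.
Proof. by move=> sgE; apply: eq_bigr => e _; rewrite sgE. Qed.

End Verifiability.

Theorem mainTheorem3 (R : realType) (n : nat) (E : {set 'I_n.+1 * 'I_n.+1})
    (Econn : connected_graph E)
    (x y : node_vec R n) (x1 : x ord0 = 0) (y1 : y ord0 = 0)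
    (eps eta : edge_vec R E) (sgE : same_signed_support eps eta) :
  verifiable x eps <-> verifiable y eta.
Proof.
rewrite !verifiable_slopeP //; split=> slope_ge0 h h1.
  by rewrite -(cost_slope_sg h sgE); apply: slope_ge0.
by rewrite (cost_slope_sg h sgE); apply: slope_ge0.
Qed.
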